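(* Let $G$ be a countable infinite discrete group acting by homeomorphisms on a compact Hausdorff space $X$, and suppose that the action $G\curvearrowright X$ is topologically free. Then the following are equivalent: (1) If $I$ and $J$ are closed nonzero ideals of $\ell^1(G\curvearrowright X)$, then $I\cap J$ is nonzero. (2) If $I$ and $J$ are closed and self-adjoint nonzero ideals of $\ell^1(G\curvearrowright X)$, then $I\cap J$ is nonzero. (3) The action $G\curvearrowright X$ is topologically transitive.
   Context: Write $\sigma_s:X\to X$ for the homeomorphism given by $s\in G$, $e$ for the identity of $G$, and $C(X)$ for the continuous functions $X\to\mathbb{C}$ with the supremum norm $\|\cdot\|_\infty$. Set $\alpha_s(f)(x)=f(\sigma_s^{-1}(x))$ for $s\in G$, $f\in C(X)$, $x\in X$. $\ell^1(G\curvearrowright X)$ is the Banach $*$-algebra of all functions $f:G\to C(X)$ with $\|f\|=\sum_{s\in G}\|f(s)\|_\infty<\infty$, with pointwise linear operations, product $(fg)(s)=\sum_{t\in G}f(t)\,\alpha_t(g(t^{-1}s))$ and involution $(f^* )(s)=\alpha_s(\overline{f(s^{-1})})$. ''Ideal'' means two-sided ideal. An ideal $I$ is self-adjoint if $f^*\in I$ for every $f\in I$. The action is topologically free if the set $\{x\in X:\sigma_s(x)\neq x\text{ for all }s\in G\setminus\{e\}\}$ is dense in $X$. The action is topologically transitive if for every pair of nonempty open subsets $U,V$ of $X$ there is some $s\in G$ such that $\sigma_s(U)\cap V\neq\emptyset$. *)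

(* Defs.v *)
From mathcomp Require Import all_boot all_order all_algebra finmap.
From mathcomp Require Import all_classical all_reals all_analysis.
From mathcomp Require Import showcase.summability.
From mathcomp Require Import complex.

Set Implicit Arguments.
Unset Strict Implicit.
Unset Printing Implicit Defensive.

Import Order.TTheory GRing.Theory Num.Theory.
Import numFieldNormedType.Exports.

Local Open Scope classical_set_scope.
Local Open Scope ring_scope.

(* The topology of [R[i]] is that of its modulus, carried by the alias
   [(R[i])^o]. *)
Notation Cplx R := ((R[i])^o).

Section Action.
Context {G : groupType} {X : topologicalType}.
Implicit Type sigma : G -> X -> X.

(* Each [sigma s] is then a homeomorphism, with inverse [sigma s^-1]. *)
Definition continuous_action sigma : Prop :=
  [/\ forall x, sigma 1%g x = x,
      forall s t x, sigma (s * t)%g x = sigma s (sigma t x)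
    & forall s, continuous (sigma s)].

Definition topologically_free sigma : Prop :=
  dense [set x | forall s, s != 1%g -> sigma s x <> x].

Definition topologically_transitive sigma : Prop :=
  forall U V : set X, open U -> U !=set0 -> open V -> V !=set0 ->
    exists s, (sigma s @` U) `&` V !=set0.

End Action.

Section EllOne.
Context {R : realType} {G : groupType} {X : topologicalType}.
Implicit Types (h : X -> Cplx R) (f g : G -> X -> Cplx R).

(* Meaningful for bounded [h], in particular for continuous [h] on compact
   [X]; it is [0] when [X] is empty. *)
Definition supnorm h : R := sup [set Normc.normc (h x) | x in [set: X]].

Definition ell1_norm f : \bar R := \esum_(s in [set: G]) (supnorm (f s))%:E.

(* Elements of C(X) are represented by their underlying functions, so that
   operations need not carry proofs of continuity and summability. *)
Definition ell1 : set (G -> X -> Cplx R) :=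
  [set f | (forall s, continuous (f s)) /\ (ell1_norm f < +oo)%E].

Section Operations.
Variable sigma : G -> X -> X.

Definition alpha (s : G) h : X -> Cplx R := fun x => h (sigma s^-1%g x).

(* The series converges in C(X): its partial sums over the finite subsets of
   [G] have a unique limit for uniform convergence on [X], i.e. for the sup
   norm, whenever [f] and [g] are in [ell1]. *)
Definition ell1_mul f g : G -> X -> Cplx R := fun s =>
  get [set h : X -> Cplx R |
    {uniform, partial_sum (fun t => f t * alpha t (g (t^-1 * s)%g)) @ totally
              --> h}].

Definition ell1_star f : G -> X -> Cplx R := fun s =>
  alpha s (fun x => conjc (f s^-1%g x)).

Definition ell1_ideal (I : set (G -> X -> Cplx R)) : Prop :=
  [/\ I `<=` ell1,
      I 0,
      forall f g, I f -> I g -> I (f + g),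
      forall (c : Cplx R) f, I f -> I (fun s x => c * f s x)
    & forall a f, ell1 a -> I f -> I (ell1_mul a f) /\ I (ell1_mul f a)].

Definition self_adjoint (I : set (G -> X -> Cplx R)) : Prop :=
  forall f, I f -> I (ell1_star f).

End Operations.

Definition ell1_closed (I : set (G -> X -> Cplx R)) : Prop :=
  forall f, ell1 f ->
    (forall e : R, 0 < e -> exists2 g, I g & (ell1_norm (f - g)%R < e%:E)%E) ->
    I f.

Definition nonzero (I : set (G -> X -> Cplx R)) : Prop :=
  exists2 f, I f & f <> 0.

End EllOne.

(* Main.v *)
(** Primality of the algebra amounts to transitivity because of two constructions.
    If [U] and [V] are nonempty open sets with disjoint orbits, the functions
    supported in the orbit of [U], respectively of [V], form nonzero closed
    self-adjoint ideals with zero intersection.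

    Conversely, every nonzero closed ideal [I] meets [C(X)].  Some [a] in [I] has
    [a(e)(x) = 1] at a point [x] with trivial stabiliser.  For a bump function
    [f] concentrated near [x], the element [f a f] of [I] equals [f^2 + r] with
    [|r| <= 1/2]: the coefficients of [f a f] at finitely many [s <> e] vanish
    because [sigma_s] moves the support of [f] off itself, and the others are small.
    If [g] in [C(X)] satisfies [f g = g], then [(1 + r) g = f a f g] lies in
    [I], and inverting [1 + r] by a Neumann series puts [g] in [I].  Given nonzero
    [g] in [I] and [h] in [C(X)] in [J], transitivity provides [s] with
    [g * delta_s * h <> 0]. *)

Require Import Defs.
From mathcomp Require Import all_boot all_order all_algebra finmap.
From mathcomp Require Import all_classical all_reals all_analysis.
From mathcomp Require Import showcase.summability complex.
From mathcomp Require Import ring lra.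

Set Implicit Arguments.
Unset Strict Implicit.
Unset Printing Implicit Defensive.

Import Order.TTheory GRing.Theory Num.Theory.
Import numFieldNormedType.Exports.
Import Normc.

Local Open Scope classical_set_scope.
Local Open Scope ring_scope.

(** * Nonnegative families and bounds on their finite partial sums *)

Section Sums.
Context {R : realType} {T : choiceType}.
Implicit Types (a b : T -> R) (F D : {fset T}).

(** Bounding all finite partial sums keeps the estimates in [R]; for a nonnegative family, having
    some bound [B] amounts to summability. *)
Definition sums_le a (B : R) := forall F, \sum_(t <- F) a t <= B.

(** [fine] sends an infinite sum to [0], so for nonnegative families the value is used only
    alongside some [sums_le] bound. *)
Definition tsum a : R := fine (\esum_(t in [set: T]) (a t)%:E).

Lemma esum_leP a B : (\esum_(t in [set: T]) (a t)%:E <= B%:E)%E <-> sums_le a B.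
Proof.
split=> [aB F|aB].
  rewrite -lee_fin; apply: le_trans aB; apply: esum_ge.
  exists [set` F]; first by split.
  by rewrite fsbig_finite//= set_fsetK sumEFin.
apply: ge_ereal_sup => _ [D [fD _] <-].
by rewrite fsbig_finite//= sumEFin lee_fin.
Qed.

Lemma esum_ltyP a : (forall t, 0 <= a t) ->
  (\esum_(t in [set: T]) (a t)%:E < +oo)%E <-> exists B, sums_le a B.
Proof.
move=> a0; split=> [aoo|[B /esum_leP aB]]; last exact: le_lt_trans aB (ltry _).
exists (tsum a); apply/esum_leP; rewrite fineK// ge0_fin_numE//.
by apply: esum_ge0 => t _; rewrite lee_fin.
Qed.

Lemma sums_le_ge0 a B : sums_le a B -> 0 <= B.
Proof. by move=> /(_ fset0); rewrite big_seq_fset0. Qed.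

Lemma tsumE a B : (forall t, 0 <= a t) -> sums_le a B ->
  (tsum a)%:E = \esum_(t in [set: T]) (a t)%:E.
Proof.
move=> a0 aB; rewrite fineK// ge0_fin_numE; first by apply/esum_ltyP => //; exists B.
by apply: esum_ge0 => t _; rewrite lee_fin.
Qed.

Lemma tsum_ub a B : (forall t, 0 <= a t) -> sums_le a B -> sums_le a (tsum a).
Proof. by move=> a0 aB; apply/esum_leP; rewrite -(tsumE a0 aB). Qed.

Lemma tsum_le a B : (forall t, 0 <= a t) -> sums_le a B -> tsum a <= B.
Proof. by move=> a0 aB; rewrite -lee_fin (tsumE a0 aB); apply/esum_leP. Qed.

Lemma tsum_approx a B (e : R) : (forall t, 0 <= a t) -> sums_le a B -> 0 < e ->
  exists F, tsum a - e < \sum_(t <- F) a t.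
Proof.
move=> a0 aB e0; apply/not_existsP => H.
suff : tsum a <= tsum a - e by lra.
by apply: (tsum_le a0) => F; rewrite leNgt; apply/negP/H.
Qed.

Lemma sum_fsetU_disjoint a F D : (F `&` D = fset0)%fset ->
  \sum_(t <- (F `|` D)%fset) a t = \sum_(t <- F) a t + \sum_(t <- D) a t.
Proof.
move=> FD; rewrite -big_cat; apply: perm_big.
apply: uniq_perm; first exact: fset_uniq.
  rewrite cat_uniq !fset_uniq andbT/=; apply/hasPn => t tD; apply/negP => tF.
  by have := in_fset0 t; rewrite -FD in_fsetI tD tF.
by move=> t; rewrite mem_cat in_fsetU.
Qed.

Lemma fsetU_fsetD_sum a F D :
  \sum_(t <- (F `|` D)%fset) a t = \sum_(t <- F) a t + \sum_(t <- (D `\` F)%fset) a t.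
Proof.
rewrite -sum_fsetU_disjoint; last by apply/fsetP => t; rewrite !inE; case: (t \in F).
by apply: eq_fbigl => t; rewrite !inE; case: (t \in F).
Qed.

Lemma ler_sum_fsetS a F D : (forall t, 0 <= a t) -> (F `<=` D)%fset ->
  \sum_(t <- F) a t <= \sum_(t <- D) a t.
Proof.
move=> a0 /fsetUidPr <-; rewrite fsetU_fsetD_sum lerDl.
exact: sumr_ge0.
Qed.

(** A finite set whose partial sum is within [e] of the total leaves at most [e] to any finite set
    disjoint from it. *)
Lemma tsum_tail a B (e : R) : (forall t, 0 <= a t) -> sums_le a B -> 0 < e ->
  exists F, forall D, (F `&` D = fset0)%fset -> \sum_(t <- D) a t <= e.
Proof.
move=> a0 aB e0; have [F HF] := tsum_approx a0 aB e0.
exists F => D FD; have := tsum_ub a0 aB (F `|` D)%fset.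
by rewrite sum_fsetU_disjoint//; lra.
Qed.

Lemma tsum_err a B (e : R) F : (forall t, 0 <= a t) -> sums_le a B ->
  (forall D, (F `&` D = fset0)%fset -> \sum_(t <- D) a t <= e) ->
  `|tsum a - \sum_(t <- F) a t| <= e.
Proof.
move=> a0 aB Fe; rewrite ger0_norm; last by rewrite subr_ge0; exact: tsum_ub a0 aB F.
rewrite lerBlDl; apply: tsum_le => // D.
apply: (@le_trans _ _ (\sum_(t <- (F `|` D)%fset) a t)).
  by apply: ler_sum_fsetS => //; apply: fsubsetUr.
rewrite fsetU_fsetD_sum lerD2l; apply: Fe.
by apply/fsetP => t; rewrite !inE; case: (t \in F).
Qed.

Lemma sums_le_single s (c : R) : 0 <= c -> sums_le (fun t => if t == s then c else 0) c.
Proof.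
move=> c0 F; have [sF|sF] := boolP (s \in F).
  rewrite (big_fsetD1 s)//= eqxx big1_seq ?addr0//.
  by move=> t; rewrite !inE => /andP[_ /andP[/negbTE ->]].
rewrite big1_seq// => t /andP[_ tF].
by case: eqP => // ts; rewrite -ts tF in sF.
Qed.

(** Tonelli for a finite outer sum. It yields the submultiplicativity of the norm. *)
Lemma sum_tsum_le (S : choiceType) (c : S -> T -> R) (B : S -> R) (F : {fset S}) K :
  (forall s t, 0 <= c s t) -> (forall s, sums_le (c s) (B s)) ->
  sums_le (fun t => \sum_(s <- F) c s t) K -> \sum_(s <- F) tsum (c s) <= K.
Proof.
move=> c0 cB cK; rewrite -lee_fin -sumEFin.
under eq_bigr do rewrite (tsumE (c0 _) (cB _)).
rewrite -esum_sum; last by move=> *; rewrite lee_fin.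
under eq_esum do rewrite sumEFin.
exact/esum_leP.
Qed.

End Sums.

(** * The modulus of complex numbers *)

Section Complex.
Context {R : realType}.
Implicit Types z w : Cplx R.

Lemma normc_ge0 z : 0 <= normc z.
Proof. by case: z => a b; exact: sqrtr_ge0. Qed.

Lemma normcB z w : normc (z - w) = normc (w - z).
Proof. by rewrite -opprB; exact: normcN. Qed.

Lemma normcD z w : normc (z + w) <= normc z + normc w.
Proof. exact: le_normcD. Qed.

Lemma normc_real (r : R) : normc (r%:C%C) = `|r|.
Proof. by rewrite /normc/= expr0n/= addr0 sqrtr_sqr. Qed.

Lemma normc_le_ReIm z : normc z <= `|complex.Re z| + `|complex.Im z|.
Proof.
case: z => a b /=; rewrite -[leRHS]ger0_norm ?addr_ge0// -sqrtr_sqr ler_wsqrtr//.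
rewrite sqrrD !real_normK ?num_real//.
have : 0 <= `|a| * `|b| by rewrite mulr_ge0.
by lra.
Qed.

Lemma Re_le_normc z : `|complex.Re z| <= normc z.
Proof. by case: z => a b /=; rewrite -sqrtr_sqr ler_wsqrtr// lerDl sqr_ge0. Qed.

Lemma Im_le_normc z : `|complex.Im z| <= normc z.
Proof. by case: z => a b /=; rewrite -sqrtr_sqr ler_wsqrtr// lerDr sqr_ge0. Qed.

Lemma normc_conj z : normc (conjc z) = normc z.
Proof. by case: z => a b /=; rewrite sqrrN. Qed.

Lemma eq_normc_small z w : (forall e : R, 0 < e -> normc (z - w) < e) -> z = w.
Proof.
move=> H; apply/eqP; rewrite -subr_eq0; apply/eqP/eq0_normc/eqP.
by rewrite eq_le normc_ge0 andbT; apply/ler_addgt0Pr => e e0; rewrite add0r ltW// H.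
Qed.

Lemma normc_sum (I : Type) (r : seq I) (u : I -> Cplx R) :
  normc (\sum_(i <- r) u i) <= \sum_(i <- r) normc (u i).
Proof.
elim: r => [|i r IH]; first by rewrite !big_nil normc0.
by rewrite !big_cons; apply: le_trans (normcD _ _) _; rewrite lerD2l.
Qed.

Lemma continuous_normcP (X : topologicalType) (h : X -> Cplx R) (x : X) :
  {for x, continuous h} <->
  forall e : R, 0 < e -> \forall y \near x, normc (h y - h x) < e.
Proof.
split=> [/cvgr_dist_lt H e e0|H].
  have e0' : (0 : R[i]) < e%:C%C by rewrite ltcR.
  near=> y; rewrite normcB -ltcR; near: y.
  exact: H.
(* The radius is an element of [R[i]]; its positivity forces a zero imaginary part, which reduces it
   to a real radius. *)
apply/cvgrPdist_lt => -[e i]; rewrite ltcE/= => /andP[/eqP -> e0].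
near=> y; rewrite /Num.norm/= ltcR normcB; near: y.
exact: H.
Unshelve. all: by end_near. Qed.

End Complex.

(** * Uniform convergence of unordered series *)

Section UniformSums.
Context {R : realType} {T : choiceType}.

Definition uniform_sum {X : Type} (u : T -> X -> Cplx R) (h : X -> Cplx R) :=
  forall e : R, 0 < e -> exists F : {fset T}, forall D : {fset T}, (F `<=` D)%fset ->
    forall x, normc (h x - \sum_(t <- D) u t x) < e.

Lemma partial_sumE {X : Type} (u : T -> X -> Cplx R) (D : {fset T}) (x : X) :
  partial_sum u D x = \sum_(t <- D) u t x.
Proof. by rewrite /partial_sum fct_sumE big_seq_fsetE. Qed.

Lemma uniform_sumP {X : topologicalType} (u : T -> X -> Cplx R) (h : X -> Cplx R) :
  {uniform, partial_sum u @ totally --> h} <-> uniform_sum u h.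
Proof.
split=> [uh e e0|uh].
  have e0' : (0 : R[i]) < e%:C%C by rewrite ltcR.
  have [] := uh [set g | forall x, normc (h x - g x) < e].
    apply/uniform_nbhs; exists [set z | ball z.1 (e%:C%C) z.2]; split.
      by rewrite -entourage_ballE; exists e%:C%C.
    by move=> g /= hg x; have := hg x I; rewrite /ball/= /Num.norm/= ltcR.
  move=> F _ FP; exists F => D FD x; rewrite -partial_sumE.
  exact: FP.
move=> A /uniform_nbhs[E [+ EA]]; rewrite -entourage_ballE => -[[e i]] /=.
rewrite ltcE/= => /andP[/eqP -> e0] eE.
have [F FP] := uh _ e0; exists F => // D FD; apply: EA => x _; apply: eE.
by rewrite /ball/= /Num.norm/= ltcR partial_sumE; exact: FP.
Qed.

Context {X : Type}.
Implicit Types (u v : T -> X -> Cplx R) (h k : X -> Cplx R).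

Lemma uniform_sum_unique u h k : uniform_sum u h -> uniform_sum u k -> h = k.
Proof.
move=> uh uk; apply/funext => x; apply: eq_normc_small => e e0.
have e20 : 0 < e / 2 by lra.
have [F FP] := uh _ e20; have [D DP] := uk _ e20.
have := FP _ (fsubsetUl F D) x; have := DP _ (fsubsetUr F D) x.
set S := \sum_(_ <- _) _ => kS hS.
have -> : h x - k x = (h x - S) + (S - k x) by ring.
apply: le_lt_trans (normcD _ _) _; rewrite [normc (S - _)]normcB; lra.
Qed.

Lemma uniform_sumD u v h k : uniform_sum u h -> uniform_sum v k ->
  uniform_sum (fun t x => u t x + v t x) (fun x => h x + k x).
Proof.
move=> uh vk e e0; have e20 : 0 < e / 2 by lra.
have [F FP] := uh _ e20; have [D DP] := vk _ e20.
exists (F `|` D)%fset => E; rewrite fsubUset => /andP[/FP{}FP /DP{}DP] x.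
have := FP x; have := DP x; rewrite big_split/=.
set S := \sum_(_ <- _) _; set S' := \sum_(_ <- _) _ => kS hS.
have -> : h x + k x - (S' + S) = (h x - S') + (k x - S) by ring.
by apply: le_lt_trans (normcD _ _) _; lra.
Qed.

Lemma uniform_sum_single u s : (forall t x, t != s -> u t x = 0) ->
  uniform_sum u (u s).
Proof.
move=> us e e0; exists [fset s]%fset => D sD x.
rewrite (big_fsetD1 s) ?(fsubsetP sD) ?inE//= big1_seq ?addr0 ?subrr ?normc0//.
by move=> t; rewrite !inE => /andP[_ /andP[ts _]]; exact: us.
Qed.

Lemma uniform_sum_le u h (M : T -> R) B x : uniform_sum u h ->
  (forall t, normc (u t x) <= M t) -> sums_le M B -> normc (h x) <= B.
Proof.
move=> uh uM MB; apply/ler_addgt0Pr => e e0.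
have [F /(_ F (fsubset_refl F) x) FP] := uh _ e0.
set S := \sum_(_ <- _) _ in FP.
have -> : h x = (h x - S) + S by rewrite subrK.
apply: le_trans (normcD _ _) _; rewrite [leRHS]addrC lerD ?(ltW FP)//.
apply: le_trans (MB F); apply: le_trans (normc_sum _ _) _.
exact: ler_sum.
Qed.

Lemma uniform_sum_eq0 u h x : uniform_sum u h -> (forall t, u t x = 0) -> h x = 0.
Proof.
move=> uh u0; apply: eq_normc_small => e e0; have [F FP] := uh _ e0.
by have := FP F (fsubset_refl F) x; rewrite big1.
Qed.

(** Real and imaginary parts are summed separately. Adding [M] makes each of them nonnegative, and
    the total of [M] is subtracted afterwards. The errors are controlled by tails of [M] alone,
    hence uniformly in [x]. *)
Lemma weierstrass_test u (M : T -> R) B :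
  (forall t x, normc (u t x) <= M t) -> sums_le M B -> exists h, uniform_sum u h.
Proof.
move=> uM MB; have M0 t (x : X) : 0 <= M t by apply: le_trans (uM t x); exact: normc_ge0.
(* Without a point in [X], nothing makes [M] nonnegative; on the empty space any function is a
   uniform sum. *)
have [x0|nX] := pselect (inhabited X); last first.
  by exists (fun=> 0) => e e0; exists fset0 => D _ x; case: nX.
have {}M0 t : 0 <= M t by case: x0 => x; exact: M0 x.
have real_sum (r : T -> X -> R) : (forall t x, `|r t x| <= M t) ->
    exists k : X -> R, forall x F (e : R),
      (forall D, (F `&` D = fset0)%fset -> \sum_(t <- D) M t <= e) ->
      `|k x - \sum_(t <- F) r t x| <= 3 * e.
  (* The error [3 * e] is [2 * e] for the shifted family, majorised by [2 * M], plus [e] for [M]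
     itself. *)
  move=> rM; exists (fun x => tsum (fun t => r t x + M t) - tsum M) => x F e Fe.
  have MMB : sums_le (fun t => r t x + M t) (2 * B).
    move=> D; apply: (@le_trans _ _ (\sum_(t <- D) 2 * M t)).
      by apply: ler_sum => t _; have := rM t x; rewrite ler_norml; lra.
    by rewrite -mulr_sumr ler_wpM2l.
  have MM0 t : 0 <= r t x + M t by have := rM t x; rewrite ler_norml; lra.
  have := tsum_err M0 MB Fe.
  have : `|tsum (fun t => r t x + M t) - \sum_(t <- F) (r t x + M t)| <= 2 * e.
    apply: (tsum_err MM0 MMB) => D FD.
    apply: (@le_trans _ _ (\sum_(t <- D) 2 * M t)).
      by apply: ler_sum => t _; have := rM t x; rewrite ler_norml; lra.
    by rewrite -mulr_sumr ler_wpM2l// Fe.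
  rewrite big_split/= !ler_norml.
  set a := \sum_(_ <- _) _; set b := \sum_(_ <- _) _; lra.
have [k kP] := real_sum (fun t x => complex.Re (u t x))
  (fun t x => le_trans (Re_le_normc _) (uM t x)).
have [l lP] := real_sum (fun t x => complex.Im (u t x))
  (fun t x => le_trans (Im_le_normc _) (uM t x)).
exists (fun x => (k x +i* l x)%C) => e e0.
(* The real and imaginary errors, [3 * (e / 7)] each, add up to less than [e]. *)
have e0' : 0 < e / 7 by lra.
have [F FP] := tsum_tail M0 MB e0'.
exists F => D FD x; apply: le_lt_trans (normc_le_ReIm _) _.
have DP E : (D `&` E = fset0)%fset -> \sum_(t <- E) M t <= e / 7.
  move=> DE; apply: FP; apply/eqP; rewrite -fsubset0 -DE.
  exact: fsetSI.
have := kP x D _ DP; have := lP x D _ DP.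
rewrite !raddfB/= !raddf_sum/=; lra.
Qed.

End UniformSums.

Lemma uniform_sum_continuous {R : realType} {T : choiceType} {X : topologicalType}
    (u : T -> X -> Cplx R) (h : X -> Cplx R) :
  uniform_sum u h -> (forall t, continuous (u t)) -> continuous h.
Proof.
move=> uh uc x; apply/continuous_normcP => e e0.
have e30 : 0 < e / 3 by lra.
have [F /(_ F (fsubset_refl F)) FP] := uh _ e30.
have Sc : {for x, continuous (fun y => \sum_(t <- F) u t y : Cplx R)}.
  by apply: cvg_big => [|t _]; [exact: add_continuous|exact: uc].
have /continuous_normcP/(_ _ e30) := Sc.
apply: filterS => y Sxy.
have -> : h y - h x = (h y - \sum_(t <- F) u t y) +
    ((\sum_(t <- F) u t y - \sum_(t <- F) u t x) + (\sum_(t <- F) u t x - h x)).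
  by ring.
apply: le_lt_trans (normcD _ _) _.
have := normcD (\sum_(t <- F) u t y - \sum_(t <- F) u t x) (\sum_(t <- F) u t x - h x).
have := FP x; have := FP y; rewrite [normc (_ - h x)]normcB; lra.
Qed.

(** * Norm bounds and the linear structure of [ell1] *)

Section EllOneFacts.
Context {R : realType} {G : groupType} {X : topologicalType}.
Implicit Types (h k : X -> Cplx R) (f g : G -> X -> Cplx R) (A B : R).

Lemma supnorm_ge0 h : 0 <= supnorm h.
Proof.
rewrite /supnorm.
(* [sup] is [0] by convention on an empty or unbounded set. *)
have [[[_ [x _ _]] hs]|/sup_out ->//] := pselect (has_sup [set normc (h x) | x in [set: X]]).
by apply: le_trans (normc_ge0 (h x)) _; apply: ub_le_sup => //; exists x.
Qed.

Lemma supnorm_le h B : 0 <= B -> (forall x, normc (h x) <= B) -> supnorm h <= B.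
Proof.
move=> B0 hB; rewrite /supnorm.
have [->|/set0P ne] := eqVneq [set normc (h x) | x in [set: X]] set0.
  by rewrite sup0.
by apply: ge_sup => // _ [x _ <-].
Qed.

Lemma supnorm_ub h x : compact [set: X] -> continuous h -> normc (h x) <= supnorm h.
Proof.
move=> cX ch; apply: ub_le_sup; last by exists x.
have cnh : continuous (fun x => normc (h x)).
  move=> y; apply/cvgrPdist_lt => e e0.
  have /continuous_normcP/(_ _ e0) := ch y.
  apply: filterS => z; apply: le_lt_trans; rewrite ler_distl.
  have := normcD (h z - h y) (h y); have := normcD (h y - h z) (h z).
  by rewrite !subrK [normc (h y - _)]normcB; lra.
have /(continuous_compact (continuous_subspaceT cnh))/compact_bounded[M [_ MP]] := cX.
exists (M + 1) => _ [y _ <-].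
apply: le_trans (ler_norm _) _; apply: (MP (M + 1)); first by rewrite ltrDl.
by exists y.
Qed.

(** A pointwise majorant with bounded sums stands in for [ell1_norm f <= B]. It implies that bound;
    conversely, for continuous coefficients on compact [X], [supnorm] provides the majorant. *)
Definition dominated f B := exists a : G -> R,
  [/\ forall s, 0 <= a s, forall s x, normc (f s x) <= a s & sums_le a B].

Lemma ell1_norm_le f B : dominated f B -> (ell1_norm f <= B%:E)%E.
Proof.
move=> [a [a0 fa aB]]; apply/esum_leP => F; apply: le_trans (aB F).
by apply: ler_sum => s _; apply: supnorm_le.
Qed.

Lemma ell1_norm_dominated f B : compact [set: X] -> (forall s, continuous (f s)) ->
  (ell1_norm f <= B%:E)%E -> dominated f B.
Proof.
move=> cX cf /esum_leP fB; exists (fun s => supnorm (f s)); split => //.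
- by move=> s; exact: supnorm_ge0.
- by move=> s x; exact: supnorm_ub.
Qed.

Lemma ell1P f : compact [set: X] ->
  ell1 f <-> (forall s, continuous (f s)) /\ exists B, dominated f B.
Proof.
move=> cX; split=> -[cf].
  move=> /(esum_ltyP (fun s => supnorm_ge0 (f s)))[B fB]; split=> //; exists B.
  by apply: ell1_norm_dominated => //; apply/esum_leP.
move=> [B fB]; split=> //.
exact: le_lt_trans (ell1_norm_le fB) (ltry _).
Qed.

Lemma dominated_ge0 f B : dominated f B -> 0 <= B.
Proof. by move=> [a [_ _ /sums_le_ge0]]. Qed.

Lemma dominated_normc f B s x : dominated f B -> normc (f s x) <= B.
Proof.
move=> [a [_ fa /(_ [fset s]%fset)]]; rewrite big_seq_fset1.
exact: le_trans.
Qed.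

Lemma dominatedD f g A B : dominated f A -> dominated g B -> dominated (f + g) (A + B).
Proof.
move=> [a [a0 fa aA]] [b [b0 gb bB]]; exists (fun s => a s + b s); split.
- by move=> s; rewrite addr_ge0.
- by move=> s x; apply: le_trans (normcD _ _) _; rewrite lerD.
- by move=> F; rewrite big_split/= lerD.
Qed.

Lemma dominatedZ (c : Cplx R) f B : dominated f B ->
  dominated (fun s x => c * f s x) (normc c * B).
Proof.
move=> [a [a0 fa aB]]; exists (fun s => normc c * a s); split.
- by move=> s; rewrite mulr_ge0 ?normc_ge0.
- by move=> s x; rewrite normcM ler_wpM2l ?normc_ge0.
- by move=> F; rewrite -mulr_sumr ler_wpM2l ?normc_ge0.
Qed.

Lemma ell1D f g : compact [set: X] -> ell1 f -> ell1 g -> ell1 (f + g).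
Proof.
move=> cX lf lg; have [cf [A fA]] := (ell1P f cX).1 lf.
have [cg [B gB]] := (ell1P g cX).1 lg; apply: (ell1P _ cX).2.
by split; [move=> s x; apply: cvgD; [exact: cf|exact: cg]|exists (A + B); exact: dominatedD].
Qed.

Lemma ell1Z (c : Cplx R) f : compact [set: X] -> ell1 f -> ell1 (fun s x => c * f s x).
Proof.
move=> cX lf; have [cf [A fA]] := (ell1P f cX).1 lf; apply: (ell1P _ cX).2; split.
  by move=> s x; apply: cvgM; [exact: cvg_cst|exact: cf].
by exists (normc c * A); exact: dominatedZ.
Qed.

Lemma dominatedN f B : dominated f B -> dominated (- f) B.
Proof.
by move=> [a [a0 fa aB]]; exists a; split => // s x; apply: le_trans (fa s x); rewrite normcN.
Qed.

Lemma ell1N f : compact [set: X] -> ell1 f -> ell1 (- f).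
Proof.
move=> cX lf; have [cf [A fA]] := (ell1P f cX).1 lf; apply: (ell1P _ cX).2.
by split; [move=> s x; apply: cvgN; exact: cf|exists A; exact: dominatedN].
Qed.

Lemma ell10 : compact [set: X] -> ell1 (0 : G -> X -> Cplx R).
Proof.
move=> cX; apply: (ell1P _ cX).2; split; first by move=> s x; exact: cvg_cst.
exists 0, (fun=> 0); split=> //; first by move=> s x; rewrite normc0.
by move=> F; rewrite big1.
Qed.

(** The element [h * delta_s]: [s = 1] embeds C(X) in the algebra, and [h = 1] gives the group
    elements. *)
Definition single (h : X -> Cplx R) (s : G) : G -> X -> Cplx R :=
  fun t x => if t == s then h x else 0.

Lemma ell1_single h s : compact [set: X] -> continuous h -> ell1 (single h s).
Proof.
move=> cX ch; apply: (ell1P _ cX).2; split.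
  by move=> t x; rewrite /single; case: eqP => _; [exact: ch|exact: cvg_cst].
exists (supnorm h), (fun t => if t == s then supnorm h else 0); split.
- by move=> t; case: ifP => // _; exact: supnorm_ge0.
- by move=> t x; rewrite /single; case: eqP => _; [exact: supnorm_ub|rewrite normc0].
- exact/sums_le_single/supnorm_ge0.
Qed.

(** * The convolution product *)

Variable sigma : G -> X -> X.

(** [ell1_mul] selects a limit by [get], so its properties rest on a limit existing; the Weierstrass
    test with majorant [a t * B] provides one. *)
Lemma ell1_mulP f g A B s : dominated f A -> dominated g B ->
  uniform_sum (fun t x => f t x * g (t^-1 * s)%g (sigma t^-1%g x)) (ell1_mul sigma f g s).
Proof.
move=> [a [a0 fa aA]] [b [b0 gb bB]].
apply/uniform_sumP; apply: (@getPex _ [set h : X -> Cplx R |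
    {uniform, partial_sum (fun t => f t * alpha sigma t (g (t^-1 * s)%g)) @ totally
              --> h}]).
have := @weierstrass_test R G X
  (fun t x => f t x * g (t^-1 * s)%g (sigma t^-1%g x)) (fun t => a t * B) (A * B).
move=> [||h hP].
- move=> t x; rewrite normcM ler_pM ?normc_ge0//; apply: le_trans (gb _ _) _.
  by have := bB [fset (t^-1 * s)%g]%fset; rewrite big_seq_fset1.
- by move=> F; rewrite -mulr_suml ler_wpM2r//; exact: sums_le_ge0 bB.
by exists h; apply/uniform_sumP.
Qed.

Lemma sums_le_translate (b : G -> R) B t (F : {fset G}) : sums_le b B ->
  \sum_(s <- F) b (t^-1 * s)%g <= B.
Proof.
move=> bB; have := bB [fset (t^-1 * s)%g | s in F]%fset.
by rewrite big_imfset//= => x y _ _ /mulgI.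
Qed.

(** The convolution of the two majorants is a majorant of the product. Exchanging the sums and
    translating bounds its total by [A * B]. *)
Lemma dominated_mul f g A B : dominated f A -> dominated g B ->
  dominated (ell1_mul sigma f g) (A * B).
Proof.
move=> fA gB; have mulP s := ell1_mulP s fA gB.
have B0 := dominated_ge0 gB.
move: fA gB => [a [a0 fa aA]] [b [b0 gb bB]].
have bleB t : b t <= B by have := bB [fset t]%fset; rewrite big_seq_fset1.
pose c s t := a t * b (t^-1 * s)%g.
have c0 s t : 0 <= c s t by rewrite mulr_ge0.
have cAB s : sums_le (c s) (A * B).
  move=> F; apply: (@le_trans _ _ (\sum_(t <- F) a t * B)).
    by apply: ler_sum => t _; rewrite ler_wpM2l.
  by rewrite -mulr_suml ler_wpM2r.
exists (fun s => tsum (c s)); split.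
- by move=> s; apply: sums_le_ge0; exact: tsum_ub (c0 s) (cAB s).
- move=> s x; apply: (uniform_sum_le (mulP s) _ (tsum_ub (c0 s) (cAB s))) => t.
  by rewrite normcM ler_pM ?normc_ge0.
- move=> F; apply: (sum_tsum_le c0 cAB) => D.
  apply: (@le_trans _ _ (\sum_(t <- D) a t * B)).
    by apply: ler_sum => t _; rewrite -mulr_sumr ler_wpM2l// sums_le_translate.
  by rewrite -mulr_suml ler_wpM2r.
Qed.

Lemma ell1_mul_ell1 f g : compact [set: X] -> (forall s, continuous (sigma s)) ->
  ell1 f -> ell1 g -> ell1 (ell1_mul sigma f g).
Proof.
move=> cX cs lf lg; have [cf [A fA]] := (ell1P f cX).1 lf.
have [cg [B gB]] := (ell1P g cX).1 lg; apply: (ell1P _ cX).2.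
split; last by exists (A * B); exact: dominated_mul.
move=> s; apply: uniform_sum_continuous (ell1_mulP s fA gB) _ => t x.
apply: cvgM; first exact: cf.
by apply: continuous_comp; [exact: cs|exact: cg].
Qed.

Lemma ell1_mulDl f f' g A A' B : dominated f A -> dominated f' A' -> dominated g B ->
  ell1_mul sigma (f + f') g = ell1_mul sigma f g + ell1_mul sigma f' g.
Proof.
move=> fA fA' gB; apply/funext => s.
apply: (uniform_sum_unique (ell1_mulP s (dominatedD fA fA') gB)).
have := uniform_sumD (ell1_mulP s fA gB) (ell1_mulP s fA' gB).
by under eq_fun2 do rewrite -mulrDl.
Qed.

Lemma ell1_mulDr f g g' A B B' : dominated f A -> dominated g B -> dominated g' B' ->
  ell1_mul sigma f (g + g') = ell1_mul sigma f g + ell1_mul sigma f g'.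
Proof.
move=> fA gB gB'; apply/funext => s.
apply: (uniform_sum_unique (ell1_mulP s fA (dominatedD gB gB'))).
have := uniform_sumD (ell1_mulP s fA gB) (ell1_mulP s fA gB').
by under eq_fun2 do rewrite -mulrDr.
Qed.

Lemma ell1_mul_singlel h s f A B t x : dominated (single h s) A -> dominated f B ->
  ell1_mul sigma (single h s) f t x = h x * f (s^-1 * t)%g (sigma s^-1%g x).
Proof.
move=> hA fB.
rewrite (uniform_sum_unique (ell1_mulP t hA fB) (@uniform_sum_single _ _ _ _ s _)).
  by rewrite /single eqxx.
by move=> u y /negbTE us; rewrite /single us mul0r.
Qed.

Lemma ell1_mul_singler h s f A B t x : dominated (single h s) A -> dominated f B ->
  ell1_mul sigma f (single h s) t x =
  f (t * s^-1)%g x * h (sigma (t * s^-1)^-1%g x).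
Proof.
(* Only the index [u = t * s^-1] contributes, as it solves [u^-1 * t = s]. *)
move=> hA fB; rewrite (uniform_sum_unique (ell1_mulP t fB hA)
  (@uniform_sum_single _ _ _ _ (t * s^-1)%g _)).
  by rewrite /single invgM invgK -mulgA mulVg mulg1 eqxx.
move=> u y us; rewrite /single; case: eqP; rewrite ?mulr0// => E.
by move: us; rewrite -E invgM invgK mulgA mulgV mul1g eqxx.
Qed.

End EllOneFacts.

(** * Continuous functions and bump functions *)

Section ContinuousFunctions.
Context {R : realType} {X : topologicalType}.

Lemma continuous_real_complex (k : X -> R) : continuous k ->
  continuous (fun x => (k x)%:C%C : Cplx R).
Proof.
move=> ck x; apply/continuous_normcP => e e0.
have /cvgr_dist_lt/(_ _ e0) := ck x.
by apply: filterS => y; rewrite -rmorphB normc_real distrC.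
Qed.

Lemma continuous_conjc (h : X -> Cplx R) : continuous h ->
  continuous (fun x => conjc (h x) : Cplx R).
Proof.
move=> ch x; apply/continuous_normcP => e e0.
have /continuous_normcP/(_ _ e0) := ch x.
by apply: filterS => y; rewrite -rmorphB normc_conj.
Qed.

Lemma open_neq0 (h : X -> Cplx R) : continuous h -> open [set x | h x <> 0].
Proof.
move=> ch; rewrite openE => x hx.
have hx0 : 0 < normc (h x).
  by rewrite lt_neqAle normc_ge0 andbT eq_sym; apply/eqP => /eq0_normc.
have /continuous_normcP/(_ _ hx0) := ch x.
(* A zero [y] of [h] this close to [x] would give [normc (h x) < normc (h x)]. *)
apply: filterS => y /[swap] ->.
by rewrite sub0r normcN ltxx.
Qed.

(** A compact Hausdorff space is normal, so Urysohn separates [x] from the complement of an open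
    neighbourhood inside [U]. *)
Lemma bump_function (x : X) (U : set X) : compact [set: X] -> hausdorff_space X ->
  nbhs x U ->
  exists k : X -> R, [/\ continuous k, forall y, 0 <= k y <= 1, k x = 1
    & forall y, ~ U y -> k y = 0].
Proof.
move=> cX hX; rewrite nbhsE => -[V [oV Vx] VU].
have nX := compact_normal hX cX.
have VCx : ~` V `&` [set x] = set0 by rewrite -subset0 => y [/= + yx]; rewrite yx.
have [k [ck k0 k1 krange]] := @urysohn_ext_itv X R nX (~` V) [set x] 0 1
  (open_closedC oV) (@accessible_closed_set1 X (hausdorff_accessible hX) x) VCx ltr01.
exists k; split => //.
- by move=> y; have := krange (k y); rewrite /= in_itv/=; apply; exists y.
- by apply: k1; exists x.
- by move=> y Uy; apply: k0; exists y => //= /VU.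
Qed.

End ContinuousFunctions.

(** * Ideals of functions supported in an invariant set *)

Section Ideals.
Context {R : realType} {G : groupType} {X : topologicalType}.
Variable sigma : G -> X -> X.
Hypotheses (cX : compact [set: X]) (hX : hausdorff_space X)
  (sigmaP : continuous_action sigma).
Implicit Types (f g : G -> X -> Cplx R) (I J : set (G -> X -> Cplx R)).

Let sigma1 x : sigma 1%g x = x. Proof. by have [] := sigmaP. Qed.
Let sigmaM s t x : sigma (s * t)%g x = sigma s (sigma t x).
Proof. by have [] := sigmaP. Qed.
Let sigmac s : continuous (sigma s). Proof. by have [] := sigmaP. Qed.

Definition supported_in (O : set X) : set (G -> X -> Cplx R) :=
  [set f | ell1 f /\ forall s x, ~ O x -> f s x = 0].

Lemma ell1_star_ell1 f : ell1 f -> ell1 (ell1_star sigma f).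
Proof.
move=> lf; have [cf [A [a [a0 fa aA]]]] := (ell1P f cX).1 lf; apply: (ell1P _ cX).2; split.
  move=> s x; rewrite /ell1_star/alpha.
  apply: (@continuous_comp _ _ _ (sigma s^-1%g) (fun x => conjc (f s^-1%g x) : Cplx R)).
    exact: sigmac.
  by apply: continuous_conjc; exact: cf.
exists A, (fun s => a s^-1%g); split => //.
- by move=> s x; rewrite normc_conj.
- move=> F; have := aA [fset s^-1%g | s in F]%fset.
  by rewrite big_imfset//= => x y _ _ /invg_inj.
Qed.

(** For a group action the hypothesis on [O] is full invariance. The adjoint at [x] evaluates [f] at
    a translate of [x], which leaves [O] together with [x]. *)
Lemma supported_in_self_adjoint O : (forall t x, O (sigma t x) -> O x) ->
  self_adjoint sigma (supported_in O).
Proof.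
move=> Oinv f [lf f0]; split; first exact: ell1_star_ell1.
move=> s x Ox; rewrite /ell1_star/alpha f0 ?rmorph0//.
by move=> /Oinv.
Qed.

(** Evaluation at [s] and [x] is bounded by the norm, so vanishing there passes to limits. *)
Lemma supported_in_closed O : ell1_closed (supported_in O).
Proof.
move=> f lf fO; split => // s x Ox; apply: eq_normc_small => e e0.
have e20 : 0 < e / 2 by lra.
have [g [lg g0] fg] := fO _ e20.
have [cf _] := lf; have [cg _] := lg.
have cfg u : continuous ((f - g) u).
  by move=> y; apply: cvgB; [exact: cf|exact: cg].
have := dominated_normc s x (ell1_norm_dominated cX cfg (ltW fg)).
by rewrite -[(f - g) s x]/(f s x - g s x) g0//; lra.
Qed.

Lemma supported_in_ideal O : (forall t x, O (sigma t x) -> O x) ->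
  ell1_ideal sigma (supported_in O).
Proof.
move=> Oinv; split.
- by move=> f [].
- by split => //; exact: ell10.
- move=> f g [lf f0] [lg g0]; split; first exact: ell1D.
  by move=> s x Ox; rewrite -[(f + g) s x]/(f s x + g s x) f0// g0// addr0.
- move=> c f [lf f0]; split; first exact: ell1Z.
  by move=> s x Ox; rewrite f0// mulr0.
move=> a f la [lf f0]; split; split; try exact: ell1_mul_ell1.
  move=> s x Ox; have [_ [A aA]] := (ell1P a cX).1 la.
  have [_ [B fB]] := (ell1P f cX).1 lf.
  by apply: (uniform_sum_eq0 (ell1_mulP sigma s aA fB)) => t; rewrite f0 ?mulr0// => /Oinv.
move=> s x Ox; have [_ [A aA]] := (ell1P a cX).1 la.
have [_ [B fB]] := (ell1P f cX).1 lf.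
by apply: (uniform_sum_eq0 (ell1_mulP sigma s fB aA)) => t; rewrite f0 ?mul0r.
Qed.

Lemma supported_in_nonzero (U O : set X) : open U -> U !=set0 -> U `<=` O ->
  nonzero (supported_in O).
Proof.
move=> oU [x Ux] UO.
have [k [ck _ kx k0]] := bump_function cX hX (open_nbhs_nbhs (conj oU Ux)) (R := R).
exists (single (fun x => (k x)%:C%C) 1%g).
  split; first by apply: ell1_single => //; exact: continuous_real_complex.
  by move=> s y Oy; rewrite /single k0; [case: ifP|move=> /UO].
move=> /(congr1 (fun f => f 1%g x)); rewrite /single eqxx kx => /eqP.
by rewrite oner_eq0.
Qed.

Lemma transitive_of_prime :
  (forall I J,
    ell1_ideal sigma I -> ell1_closed I -> self_adjoint sigma I -> nonzero I ->
    ell1_ideal sigma J -> ell1_closed J -> self_adjoint sigma J -> nonzero J ->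
    nonzero (I `&` J)) ->
  topologically_transitive sigma.
Proof.
move=> H U V oU U0 oV V0; apply: contrapT => UV.
pose orb (W : set X) := [set x | exists s, W (sigma s x)].
have orb_inv W t x : orb W (sigma t x) -> orb W x.
  by move=> [s Ws]; exists (s * t)%g; rewrite sigmaM.
have sub_orb W : W `<=` orb W by move=> x Wx; exists 1%g; rewrite sigma1.
have [f [[_ fU] [_ fV]] f0] := H _ _
  (supported_in_ideal (@orb_inv U)) (@supported_in_closed _)
  (supported_in_self_adjoint (@orb_inv U)) (supported_in_nonzero oU U0 (@sub_orb U))
  (supported_in_ideal (@orb_inv V)) (@supported_in_closed _)
  (supported_in_self_adjoint (@orb_inv V)) (supported_in_nonzero oV V0 (@sub_orb V)).
apply: f0; apply/funext => s; apply/funext => x.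
have [Ux|/fU ->//] := pselect (orb U x); have [Vx|/fV ->//] := pselect (orb V x).
move: Ux Vx => [u Ux] [v Vx]; exfalso; apply: UV.
(* [v * u^-1] carries [sigma u x], in [U], to [sigma v x], in [V]. *)
exists (v * u^-1)%g, (sigma v x); split => //.
by exists (sigma u x) => //; rewrite -sigmaM -mulgA mulVg mulg1.
Qed.

(** * Nonzero closed ideals contain nonzero functions of C(X) *)

Lemma ell1_mul_sandwich h k (a : G -> X -> Cplx R) t x : continuous h -> continuous k ->
  ell1 a ->
  ell1_mul sigma (single h 1%g) (ell1_mul sigma a (single k 1%g)) t x =
  h x * a t x * k (sigma t^-1%g x).
Proof.
move=> ch ck la; have [_ [A aA]] := (ell1P a cX).1 la.
have [_ [B hB]] := (ell1P _ cX).1 (ell1_single (G := G) 1%g cX ch).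
have [_ [C kC]] := (ell1P _ cX).1 (ell1_single (G := G) 1%g cX ck).
rewrite (ell1_mul_singlel sigma _ _ hB (dominated_mul sigma aA kC)).
by rewrite (ell1_mul_singler sigma _ _ kC aA) !invg1 mul1g mulg1 sigma1 mulrA.
Qed.

(** Right multiplication by [delta_(s^-1)] moves a nonzero coefficient at [s] to the identity. It
    stays nonzero on an open set, where density supplies a free point; dividing by the value there
    normalises it. *)
Lemma ideal_normalized_element I : topologically_free sigma -> ell1_ideal sigma I ->
  nonzero I ->
  exists2 a, I a & exists2 x, a 1%g x = 1 & forall s, s != 1%g -> sigma s x <> x.
Proof.
move=> sfree [Iell1 _ _ IZ IM] [f If f0].
have [s [y fsy]] : exists s y, f s y <> 0.
  apply: contrapT => H; apply: f0; apply/funext => s; apply/funext => y.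
  by apply: contrapT => fsy; apply: H; exists s, y.
have c1 : continuous (fun _ : X => 1 : Cplx R) by move=> x; exact: cvg_cst.
pose a := ell1_mul sigma f (single (fun=> 1) s^-1%g).
have Ia : I a by apply: (IM _ _ _ If).2; exact: ell1_single.
have ay : a 1%g y = f s y.
  have [_ [A fA]] := (ell1P f cX).1 (Iell1 _ If).
  have [_ [B hB]] := (ell1P _ cX).1 (ell1_single (G := G) s^-1%g cX c1).
  by rewrite /a (ell1_mul_singler sigma _ _ hB fA) mulr1 mul1g invgK.
have [ca _] := Iell1 _ Ia.
have [||x [ax xfree]] := sfree [set x | a 1%g x <> 0].
- by exists y; rewrite /= ay.
- exact: (open_neq0 (ca 1%g)).
exists (fun t z => (a 1%g x)^-1 * a t z); first exact: IZ.
by exists x => //; rewrite mulVf//; apply/eqP.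
Qed.

(** Induction on [F]: for each [s] other than [1], disjoint open sets [A] around [sigma s^-1 x] and
    [B] around [x] exist, and [W] is cut down to points of [B] that [sigma s^-1] sends into [A]. *)
Lemma wandering_nbhs x (F : seq G) : (forall s, s != 1%g -> sigma s x <> x) ->
  exists2 W, nbhs x W &
    forall s, s \in F -> s != 1%g -> forall y, W y -> ~ W (sigma s^-1%g y).
Proof.
move=> xfree; elim: F => [|s F [W xW WP]]; first by exists setT => //; exact: filterT.
have [->|s1] := eqVneq s 1%g.
  exists W => // t; rewrite inE => /orP[/eqP ->|]; first by rewrite eqxx.
  exact: WP.
have sx : sigma s^-1%g x != x by apply/eqP/xfree; rewrite invg_eq1.
move: hX; rewrite open_hausdorff => /(_ _ _ sx)[[A B] /= [Asx Bx] [oA oB /eqP AB]].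
exists (W `&` (B `&` (sigma s^-1%g @^-1` A))).
  apply: filterI => //; apply: filterI.
    by apply: open_nbhs_nbhs; split => //; exact: set_mem.
  by apply: sigmac; apply: open_nbhs_nbhs; split => //; exact: set_mem.
move=> t; rewrite inE => /orP[/eqP -> _|tF t1] y [Wy [By Ay]] [Wty [Bty _]].
  by have : (A `&` B) (sigma s^-1%g y) by []; rewrite AB.
exact: WP Wty.
Qed.

Lemma ideal_near_idempotent I : topologically_free sigma -> ell1_ideal sigma I ->
  nonzero I ->
  exists (p g : X -> Cplx R) (r : G -> X -> Cplx R),
    [/\ continuous p /\ continuous g, I (single p 1%g + r), dominated r (1 / 2),
        forall x, p x * g x = g x & exists x, g x <> 0].
Proof.
move=> sfree idI I0.
have [a Ia [x a1 xfree]] := ideal_normalized_element sfree idI I0.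
have [Iell1 _ ID IZ IM] := idI.
have [ca [A [b [b0 ab bA]]]] := (ell1P a cX).1 (Iell1 _ Ia).
(* Half of the bound [1 / 2] on [r] goes to the coefficients outside a finite set [F], half to the
   identity coefficient. *)
have q0 : 0 < 1 / 4 :> R by lra.
have [F FP] := tsum_tail b0 bA q0.
have [W xW WP] := wandering_nbhs (enum_fset F) xfree.
have [|k [ck k01 kx kV]] := @bump_function R X x
    (W `&` [set y | normc (a 1%g y - 1) < 1 / 4]) cX hX.
  apply: filterI => //; rewrite -a1.
  by have /continuous_normcP := ca 1%g x; exact.
(* [g] vanishes where [k <= 1 / 2] and [f] is [1] where [k >= 1 / 2], so [f * g = g]; the two agree
   with [1] at [x]. *)
pose f y : Cplx R := (Num.min 1 (2 * k y))%:C%C.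
pose g y : Cplx R := (Num.max 0 (2 * k y - 1))%:C%C.
have c2k : continuous (fun y => 2 * k y).
  by move=> y; apply: cvgM; [exact: cvg_cst|exact: ck].
have cf : continuous f.
  apply: continuous_real_complex => y.
  by apply: (continuous_min (f := fun=> 1) (g := fun y => 2 * k y)); [exact: cvg_cst|exact: c2k].
have cg : continuous g.
  apply: continuous_real_complex => y.
  apply: (continuous_max (f := fun=> 0) (g := fun y => 2 * k y - 1)); first exact: cvg_cst.
  by apply: cvgB; [exact: c2k|exact: cvg_cst].
have f1 y : normc (f y) <= 1.
  by rewrite normc_real ger0_norm ?ge_min ?lexx// le_min; have := k01 y; lra.
have fV y : ~ (W `&` [set y | normc (a 1%g y - 1) < 1 / 4]) y -> f y = 0.
  by move=> /kV ky; rewrite /f ky mulr0 min_r.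
pose p y := f y * f y.
have cp : continuous p by move=> y; apply: cvgM; exact: cf.
pose c := ell1_mul sigma (single f 1%g) (ell1_mul sigma a (single f 1%g)).
have Ic : I c.
  apply: (IM _ _ (ell1_single _ cX cf) _).1.
  exact: (IM _ _ (ell1_single _ cX cf) Ia).2.
have cE t y : c t y = f y * a t y * f (sigma t^-1%g y).
  by apply: ell1_mul_sandwich => //; exact: Iell1.
exists p, g, (c - single p 1%g); split => //.
- by rewrite addrC subrK.
(* [m1] pays for the identity coefficient and [m2] for the tail; at the other elements of [F] the
   coefficient of [r] is zero. *)
- pose m1 (t : G) : R := if t == 1%g then 1 / 4 else 0.
  pose m2 (t : G) : R := if t \in F then 0 else b t.
  have m10 t : 0 <= m1 t by rewrite /m1; case: ifP => // _; lra.
  have m20 t : 0 <= m2 t by rewrite /m2; case: ifP.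
  exists (fun t => m1 t + m2 t); split; first by move=> t; rewrite addr_ge0.
    move=> t y; rewrite -[(c - _) t y]/(c t y - single p 1%g t y) cE /single.
    have [->|t1] := eqVneq t 1%g.
      rewrite invg1 sigma1.
      have -> : f y * a 1%g y * f y - p y = f y * f y * (a 1%g y - 1) by rewrite /p; ring.
      apply: (@le_trans _ _ (1 / 4)); last by rewrite /m1 eqxx lerDl.
      have [[Wy /= ay]|/fV ->] := pselect ((W `&` [set y | normc (a 1%g y - 1) < 1 / 4]) y).
        rewrite !normcM; apply: le_trans (ltW ay).
        by rewrite ler_piMl ?normc_ge0// mulr_ile1 ?normc_ge0.
      by rewrite !mul0r normc0; lra.
    rewrite subr0 /m1 (negbTE t1) add0r /m2; case: ifPn => tF.
      (* [y] and [sigma t^-1 y] are never both in [W], so one of the two factors [f] vanishes. *)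
      suff -> : f y * a t y * f (sigma t^-1%g y) = 0 by rewrite normc0.
      have [[Wy _]|/fV ->] := pselect ((W `&` [set y | normc (a 1%g y - 1) < 1 / 4]) y);
        last by rewrite !mul0r.
      by rewrite (fV (sigma t^-1%g y)) ?mulr0// => -[] /(WP _ tF t1 _ Wy).
    rewrite !normcM -[leRHS]mulr1 ler_pM ?mulr_ge0 ?normc_ge0//.
    by rewrite -[leRHS]mul1r ler_pM ?normc_ge0.
  move=> D; rewrite big_split/=.
  have : \sum_(t <- D) m1 t <= 1 / 4 by apply: sums_le_single; lra.
  suff : \sum_(t <- D) m2 t <= 1 / 4 by lra.
  (* Enlarging [D] by [F] costs nothing, since [m2] vanishes on [F]; what remains is a tail sum. *)
  apply: le_trans (ler_sum_fsetS m20 (fsubsetUr F D)) _.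
  rewrite fsetU_fsetD_sum big1_seq ?add0r; last by move=> t /andP[_ tF]; rewrite /m2 tF.
  apply: le_trans (FP (D `\` F)%fset _); last first.
    by apply/fsetP => t; rewrite !inE; case: (t \in F).
  by apply: ler_sum => t _; rewrite /m2; case: ifP.
- move=> y; rewrite /p /f /g -!rmorphM/=; congr (_%:C)%C.
  have [ky|ky] := leP (1 / 2) (k y).
    by rewrite min_l ?mul1r//; lra.
  by rewrite [Num.max _ _]max_l ?mulr0//; lra.
- exists x; rewrite /g kx max_r; last by lra.
  by move=> /(congr1 (@complex.Re R)) /=; lra.
Qed.

(** The Neumann series becomes an iteration inside [I]. As [p g = g], the element
    [(p + r) g = g + r g] lies in [I]; if [i] in [I] misses [g] by [d], then [(p + r) g - r i]
    misses it by [- r d], with half the bound. Closedness of [I] concludes. *)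
Lemma ideal_meets_functions I : topologically_free sigma -> ell1_ideal sigma I ->
  ell1_closed I -> nonzero I ->
  exists g : X -> Cplx R, [/\ continuous g, I (single g 1%g) & exists x, g x <> 0].
Proof.
move=> sfree idI clI I0.
have [p [g [r [[cp cg] Ib rr pg g0]]]] := ideal_near_idempotent sfree idI I0.
have [Iell1 I00 ID IZ IM] := idI.
exists g; split => //.
have lp : ell1 (single p (1%g : G)) by exact: ell1_single.
have lg : ell1 (single g (1%g : G)) by exact: ell1_single.
have lr : ell1 r.
  have -> : r = (single p 1%g + r) - single p 1%g by rewrite addrC addKr.
  exact: (ell1D cX (Iell1 _ Ib) (ell1N cX lp)).
have IN h : I h -> I (- h).
  move=> Ih; have -> : - h = (fun s x => -1 * h s x); last exact: IZ.
  by apply/funext => s; apply/funext => x; rewrite mulN1r.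
have [_ [P pP]] := (ell1P _ cX).1 lp.
have [_ [C gC]] := (ell1P _ cX).1 lg.
have pgE : ell1_mul sigma (single p 1%g) (single g 1%g) = single g 1%g.
  apply/funext => t; apply/funext => x.
  rewrite (ell1_mul_singlel sigma _ _ pP gC) invg1 mul1g sigma1 /single.
  by case: ifP => _; [exact: pg|rewrite mulr0].
(* Multiplying [single g 1 - i] by [- r] gives [single g 1 - i'] with [i'] again in [I]. *)
have approx n : exists2 i, I i & dominated (single g 1%g - i) ((1 / 2) ^+ n * C).
  elim: n => [|n [i Ii iC]]; first by exists 0 => //; rewrite expr0 mul1r subr0.
  set d := single g 1%g - i in iC.
  have [_ [D iD]] := (ell1P _ cX).1 (Iell1 _ Ii).
  exists (ell1_mul sigma (single p 1%g + r) (single g 1%g) - ell1_mul sigma r i).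
    by apply: ID; [exact: (IM _ _ lg Ib).2|apply: IN; exact: (IM _ _ lr Ii).1].
  rewrite (ell1_mulDl sigma pP rr gC) pgE.
  have -> : ell1_mul sigma r (single g 1%g) = ell1_mul sigma r i + ell1_mul sigma r d.
    by rewrite -(ell1_mulDr sigma rr iD iC) /d addrC subrK.
  have -> : single g 1%g - (single g 1%g + (ell1_mul sigma r i + ell1_mul sigma r d) -
      ell1_mul sigma r i) = - ell1_mul sigma r d.
    by rewrite [ell1_mul sigma r i + _]addrC addrA addrK opprD addrA subrr add0r.
  by apply: dominatedN; rewrite exprS -mulrA; exact: dominated_mul.
apply: clI => // e e0.
have C0 := dominated_ge0 gC.
have [n nP] : exists n, (1 / 2) ^+ n * C < e.
  (* This [n] satisfies [C / e < 2 ^+ n]. *)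
  exists (Num.bound (C / e)); have := upper_nthrootP (leqnn (Num.bound (C / e))).
  rewrite ltr_pdivrMr// => Ce.
  by rewrite mulrC div1r exprVn ltr_pdivrMr ?exprn_gt0// mulrC.
have [i Ii iC] := approx n; exists i => //.
by apply: le_lt_trans (ell1_norm_le iC) _; rewrite lte_fin.
Qed.

Lemma prime_of_transitive I J : topologically_free sigma -> topologically_transitive sigma ->
  ell1_ideal sigma I -> ell1_closed I -> nonzero I ->
  ell1_ideal sigma J -> ell1_closed J -> nonzero J ->
  nonzero (I `&` J).
Proof.
move=> sfree strans idI clI I0 idJ clJ J0.
have [g [cg Ig [x gx]]] := ideal_meets_functions sfree idI clI I0.
have [h [ch Jh [y hy]]] := ideal_meets_functions sfree idJ clJ J0.
have [||s [_ [[u gu <-] hu]]] := strans _ _ (open_neq0 cg) _ (open_neq0 ch).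
- by exists x.
- by exists y.
have c1 : continuous (fun _ : X => 1 : Cplx R) by move=> z; exact: cvg_cst.
have lt : ell1 (single (fun=> 1 : Cplx R) s^-1%g : G -> X -> Cplx R).
  exact: ell1_single.
(* The inverse appears because [alpha] at [s^-1] composes [h] with [sigma s]: the final product has
   at [s^-1] and [u] the value [g u * h (sigma s u)], a product of nonzero numbers. *)
pose k := ell1_mul sigma (single (fun=> 1) s^-1%g) (single h 1%g).
have [Iell1 _ _ _ IM] := idI; have [Jell1 _ _ _ JM] := idJ.
have Jk : J k by exact: (JM _ _ lt Jh).1.
exists (ell1_mul sigma (single g 1%g) k).
  by split; [exact: (IM _ _ (Jell1 _ Jk) Ig).2|exact: (JM _ _ (Iell1 _ Ig) Jk).1].
have [_ [A gA]] := (ell1P _ cX).1 (Iell1 _ Ig).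
have [_ [B kB]] := (ell1P _ cX).1 (Jell1 _ Jk).
have [_ [C hC]] := (ell1P _ cX).1 (Jell1 _ Jh).
have [_ [D tD]] := (ell1P _ cX).1 lt.
move=> /(congr1 (fun f => f s^-1%g u)).
rewrite (ell1_mul_singlel sigma _ _ gA kB) invg1 mul1g sigma1.
rewrite /k (ell1_mul_singlel sigma _ _ tD hC) invgK mulgV /single eqxx mul1r.
by move=> /eqP; rewrite mulf_eq0 => /orP[/eqP|/eqP].
Qed.

End Ideals.

Theorem theorem3p13 (R : realType) (G : groupType) (X : topologicalType)
    (sigma : G -> X -> X)
    (G_countable : countable [set: G]) (G_infinite : infinite_set [set: G])
    (X_compact : compact [set: X]) (X_hausdorff : hausdorff_space X)
    (sigma_action : continuous_action sigma)
    (sigma_free : topologically_free sigma) :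
  ((forall I J : set (G -> X -> Cplx R),
      ell1_ideal sigma I -> ell1_closed I -> nonzero I ->
      ell1_ideal sigma J -> ell1_closed J -> nonzero J ->
      nonzero (I `&` J))
   <->
   (forall I J : set (G -> X -> Cplx R),
      ell1_ideal sigma I -> ell1_closed I -> self_adjoint sigma I ->
      nonzero I ->
      ell1_ideal sigma J -> ell1_closed J -> self_adjoint sigma J ->
      nonzero J ->
      nonzero (I `&` J)))
  /\
  ((forall I J : set (G -> X -> Cplx R),
      ell1_ideal sigma I -> ell1_closed I -> self_adjoint sigma I ->
      nonzero I ->
      ell1_ideal sigma J -> ell1_closed J -> self_adjoint sigma J ->
      nonzero J ->
      nonzero (I `&` J))
   <-> topologically_transitive sigma).
Proof.
have trans_prime := prime_of_transitive X_compact X_hausdorff sigma_action sigma_free.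
have prime_trans := @transitive_of_prime R _ _ _ X_compact X_hausdorff sigma_action.
split; split.
- move=> H I J iI cI _ nI iJ cJ _ nJ; exact: H.
(* The passage from self-adjoint ideals to all closed ideals goes through transitivity. *)
- by move=> /prime_trans strans I J *; exact: trans_prime.
- exact: prime_trans.
- by move=> strans I J *; exact: trans_prime.
Qed.
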